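(* Let $w \in V^*$ with $|w| = n$, let $a \in V$, and suppose $w \notin a^*$ and $w a^n \in Q_{\overline{I}}$. Then there exist words $u_1, u_2 \in V^*$ and a letter $b \in V$ with $b \ne a$ such that, setting $u = u_1 b u_2$, we have $w a^n = u^2 u_1 u_2$.
   Context: $V$ is a finite alphabet with at least two distinct letters; $V^*$ is the set of all finite words over $V$ (including the empty word), $|w|$ is the length of $w$, and $a^*$ is the set of words consisting only of the letter $a$ (including the empty word). A nonempty word $w$ is primitive if it is not of the form $v^n$ for a word $v$ and an integer $n \ge 2$; $Q$ is the set of primitive words. For a word $w$ of length $n$, $w[1..i]$ denotes its prefix of length $i$ and $w[i+1..n]$ its suffix of length $n-i$. A primitive word $w$ of length $n$ is ins-robust if for every $i \in \{0,\ldots,n\}$ and every $c \in V$ the word $w[1..i]\,c\,w[i+1..n]$ is primitive; $Q_I$ is the set of ins-robust primitive words and $Q_{\overline{I}} = Q \setminus Q_I$. *)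

(* Defs.v *)
From mathcomp Require Import all_boot.

Set Implicit Arguments.
Unset Strict Implicit.
Unset Printing Implicit Defensive.

Definition wpow (T : Type) (v : seq T) (k : nat) : seq T := flatten (nseq k v).

Definition letter_star (T : Type) (a : T) (w : seq T) : Prop :=
  exists k : nat, w = nseq k a.

Definition primitive (T : Type) (w : seq T) : Prop :=
  w <> [::] /\ ~ (exists (v : seq T) (k : nat), 2 <= k /\ w = wpow v k).

Definition insert_at (T : Type) (w : seq T) (i : nat) (c : T) : seq T :=
  take i w ++ c :: drop i w.

Definition ins_robust (T : Type) (w : seq T) : Prop :=
  primitive w /\
  forall (i : nat) (c : T), i <= size w -> primitive (insert_at w i c).

Definition non_ins_robust (T : Type) (w : seq T) : Prop :=
  primitive w /\ ~ ins_robust w.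

(* Main.v *)
Require Import Defs.
From mathcomp Require Import all_boot.
From mathcomp Require Import zify.
From Stdlib Require Import Classical_Prop.

Set Implicit Arguments.
Unset Strict Implicit.
Unset Printing Implicit Defensive.

(** Suppose that inserting [c] at position [i] turns [w a^n] into [v^k], of odd
    length [2n+1]; then [k >= 3] is odd.  No copy of [v] can consist of [a]s
    only, since [w] contains another letter.  The last copy lies within the
    positions beyond [n], where only the inserted letter can differ from [a]:
    hence [c <> a] and [c] is inserted in the last copy.  If [k >= 5], the
    copy before the last would also lie within the run of [a]s, so [k = 3]. *)

Lemma size_wpow (T : Type) (v : seq T) (k : nat) :
  size (wpow v k) = k * size v.
Proof. by elim: k => //= k IHk; rewrite size_cat IHk mulSn. Qed.

Lemma nth_wpow (T : Type) (x0 : T) (v : seq T) (k m j : nat) :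
  m < k -> j < size v -> nth x0 (wpow v k) (m * size v + j) = nth x0 v j.
Proof.
move=> + lt_jv; elim: k m => [|k IHk] [|m] //= lt_mk.
  by rewrite nth_cat mul0n add0n lt_jv.
rewrite nth_cat mulSn -addnA ltnNge leq_addr /= addKn.
exact: IHk.
Qed.

Lemma size_insert_at (T : Type) (s : seq T) (i : nat) (c : T) :
  size (insert_at s i c) = (size s).+1.
Proof. by rewrite size_cat /= addnS -size_cat cat_take_drop. Qed.

Lemma nth_insert_at (T : Type) (x0 : T) (s : seq T) (i : nat) (c : T) (j : nat) :
  i <= size s ->
  nth x0 (insert_at s i c) j =
    if j < i then nth x0 s j else if j == i then c else nth x0 s j.-1.
Proof.
move=> le_is; rewrite nth_cat size_takel //; case: ltnP => [lt_ji|le_ij].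
  by rewrite nth_take.
case: eqVneq => [->|ne_ji]; first by rewrite subnn.
have -> : j - i = (j.-1 - i).+1 by lia.
by rewrite /= nth_drop; congr nth; lia.
Qed.

(** With [a] itself as the default value, no upper bound on [j] is needed: past the end [nth] also
    returns [a]. *)
Lemma nth_cat_nseq_default (T : Type) (a : T) (w : seq T) (n j : nat) :
  size w <= j -> nth a (w ++ nseq n a) j = a.
Proof. by move=> le_wj; rewrite nth_cat ltnNge le_wj /= nth_nseq if_same. Qed.

(** All copies of [v] are equal, so one copy made of [a]s spreads to the whole power. *)
Lemma all_wpow_block (T : eqType) (a : T) (v : seq T) (k m : nat) :
  m < k ->
  (forall j, m * size v <= j < m.+1 * size v -> nth a (wpow v k) j = a) ->
  all (pred1 a) (wpow v k).
Proof.
move=> lt_mk block_a.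
have /all_pred1P -> : all (pred1 a) v.
  apply/(all_nthP a) => j lt_jv /=.
  rewrite -(nth_wpow a lt_mk lt_jv) block_a //.
  by rewrite leq_addr mulSn addnC ltn_add2r.
rewrite /wpow; elim: k {lt_mk block_a} => //= k IHk.
by rewrite all_cat all_pred1_nseq.
Qed.

Lemma insert_at_last_block (T : eqType) (v s : seq T) (k i : nat) (c : T) :
  i <= size s -> insert_at s i c = wpow v k.+1 ->
  k * size v <= i ->
  let t := i - k * size v in
  v = take t v ++ c :: drop t.+1 v /\ s = wpow v k ++ take t v ++ drop t.+1 v.
Proof.
move=> le_is def_x le_i t.
have size_x : (size s).+1 = k.+1 * size v.
  by rewrite -size_wpow -def_x size_insert_at.
have lt_tv : t < size v by rewrite /t; lia.
have wpowSr : wpow v k.+1 = wpow v k ++ v.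
  by rewrite /wpow -addn1 nseqD flatten_cat /= cats0.
(* Position [i] of the power is offset [t] of its last copy. *)
have nth_t : nth c v t = c.
  rewrite -(nth_wpow c (ltnSn k) lt_tv) -def_x nth_insert_at // /t.
  by rewrite subnKC // ltnn eqxx.
have def_v : v = take t v ++ c :: drop t.+1 v.
  by rewrite -[in c :: _]nth_t -(drop_nth c lt_tv) cat_take_drop.
split=> //; move: def_x; rewrite wpowSr [X in _ ++ X]def_v catA => /eqP.
(* Both sides can be split at the inserted letter, since the parts to its left both have length
   [i]. *)
rewrite eqseq_cat; last first.
  by rewrite size_cat size_wpow !size_takel // ?(ltnW lt_tv) /t // subnKC.
rewrite eqseq_cons => /and3P[/eqP def_l _ /eqP def_r].
by rewrite -[LHS](cat_take_drop i) def_l def_r catA.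
Qed.

Lemma insert_power_last_block (T : eqType) (w v : seq T) (a c : T) (i k : nat) :
  let n := size w in
  ~~ all (pred1 a) w -> i <= size (w ++ nseq n a) -> 2 <= k ->
  insert_at (w ++ nseq n a) i c = wpow v k ->
  [/\ c <> a, k = 3 & 2 * size v <= i].
Proof.
move=> n not_a le_i k_gt1 def_x; set s := w ++ nseq n a in le_i def_x.
have size_x : (2 * n).+1 = k * size v.
  by rewrite -size_wpow -def_x size_insert_at size_cat size_nseq -/n addnn mul2n.
have no_a_block m : m < k ->
    ~ (forall j, m * size v <= j < m.+1 * size v -> nth a (wpow v k) j = a).
  (* Deleting the inserted letter from a word of [a]s would leave only [a]s in [s], hence in its
     prefix [w]. *)
  move=> lt_mk /(all_wpow_block lt_mk); rewrite -def_x all_cat /=.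
  case/and3P=> all_l _ all_r; move/negP: not_a; apply.
  have : all (pred1 a) s by rewrite -(cat_take_drop i s) all_cat all_l.
  by rewrite all_cat => /andP[].
(* The bound is strict because a position after [i] shows the letter of [s] at [j.-1], which must
   still be at least [n]. *)
have nth_x j : n < j -> j != i -> nth a (wpow v k) j = a.
  move=> lt_nj ne_ji; rewrite -def_x nth_insert_at // (negPf ne_ji).
  by case: ifP => _; apply: nth_cat_nseq_default; rewrite -/n; lia.
have k_odd : odd k.
  have /(congr1 odd) : (2 * n).+1 = k * size v by [].
  by rewrite oddS !oddM /= => /esym/andP[].
have k_ge3 : 2 < k by lia.
(* The first [k.-1] copies fill at least two thirds of the length [2 * n + 1]. *)
have le_last : n < k.-1 * size v by nia.
have le_i_last : k.-1 * size v <= i.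
  rewrite leqNgt; apply/negP => lt_i.
  by apply: (no_a_block k.-1) => [|j /andP[le_j _]]; [lia | apply: nth_x; lia].
have ne_ca : c <> a.
  move=> eq_ca; apply: (no_a_block k.-1) => [|j /andP[le_j _]]; first lia.
  have [->|] := eqVneq j i; last by apply: nth_x; lia.
  by rewrite -def_x nth_insert_at // ltnn eqxx.
have def_k : k = 3.
  apply/eqP; rewrite eqn_leq k_ge3 andbT leqNgt; apply/negP => k_gt3.
  have k_ge5 : 4 < k by lia.
  (* Now [k.-2] copies fill at least three fifths of the length. The weak bound suffices, as
     positions before [i] are not shifted. *)
  have le_prev : n <= k.-2 * size v by nia.
  apply: (no_a_block k.-2) => [|j /andP[le_j lt_j]]; first lia.
  have lt_ji : j < i by apply: leq_trans le_i_last; rewrite prednK in lt_j; lia.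
  rewrite -def_x nth_insert_at // lt_ji.
  by apply: nth_cat_nseq_default; apply: leq_trans le_j.
by split=> //; move: le_i_last; rewrite def_k.
Qed.

Theorem theorem15 (V : finType) (hV : 2 <= #|V|) (n : nat) (w : seq V) (a : V)
    (hn : size w = n) (hw : ~ letter_star a w)
    (hQ : non_ins_robust (w ++ nseq n a)) :
  exists (u1 u2 : seq V) (b : V),
    b <> a /\
    let u := u1 ++ b :: u2 in
    w ++ nseq n a = wpow u 2 ++ u1 ++ u2.
Proof.
have not_a : ~~ all (pred1 a) w.
  by apply/negP => /all_pred1P def_w; apply: hw; exists (size w).
(* Classically, it is enough to derive robustness from the absence of a factorization. *)
case: hQ => prim_s not_robust; apply: NNPP => no_factor.
apply: not_robust; split=> // i c le_i; split=> [|[v [k [k_gt1 def_x]]]].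
  by move/(congr1 size); rewrite size_insert_at.
subst n; have [ne_ca def_k le_vi] := insert_power_last_block not_a le_i k_gt1 def_x.
rewrite def_k in def_x.
have [def_v def_s] := insert_at_last_block le_i def_x le_vi.
(* Here [u] is [v] and [b] is the inserted letter [c], whose offset in the third copy is
   [i - 2 * size v]. *)
apply: no_factor; exists (take (i - 2 * size v) v), (drop (i - 2 * size v).+1 v), c.
by split=> //=; rewrite -def_v.
Qed.
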